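(* Let $\mathbb{X}$ be a linearly ordered radicable idempotent commutative semifield, let $n\geq1$, and let $A,B\in\mathbb{X}^{n\times n}$. Suppose that at least one of the matrices $A$ and $B$ is irreducible, that the spectral radius $\lambda$ of $A$ satisfies $\lambda>\mathbb{0}$, and that $\mathrm{Tr}(B)\leq\mathbb{1}$. Consider the problem of minimizing $\bm{x}^{-}A\bm{x}$ over all regular vectors $\bm{x}\in\mathbb{X}_{+}^{n}$ satisfying $B\bm{x}\leq\bm{x}$. Then the minimum exists and is equal to $$ \theta=\bigoplus_{k=1}^{n}\ \bigoplus_{0\leq i_{1}+\cdots+i_{k}\leq n-k}\mathrm{tr}^{1/k}(AB^{i_{1}}\cdots AB^{i_{k}}), $$ where the inner sum is over all $k$-tuples of nonnegative integers $i_{1},\ldots,i_{k}$ with $i_{1}+\cdots+i_{k}\leq n-k$. Moreover, the minimum is attained exactly at the vectors of the form $$ \bm{x}=(\theta^{-1}A\oplus B)^{\ast}\bm{u},\qquad \bm{u}\in\mathbb{X}_{+}^{n}; $$ that is, a regular vector $\bm{x}$ satisfies $B\bm{x}\leq\bm{x}$ and $\bm{x}^{-}A\bm{x}=\theta$ if and only if $\bm{x}=(\theta^{-1}A\oplus B)^{\ast}\bm{u}$ for some regular vector $\bm{u}$.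
   Context: An idempotent commutative semifield $\langle\mathbb{X},\mathbb{0},\mathbb{1},\oplus,\otimes\rangle$ is a set with associative and commutative operations $\oplus$ (neutral element $\mathbb{0}$) and $\otimes$ (neutral element $\mathbb{1}$, sign omitted), where multiplication distributes over addition, $\mathbb{0}$ is absorbing for multiplication, $x\oplus x=x$ for all $x$, and every $x\in\mathbb{X}_{+}=\mathbb{X}\setminus\{\mathbb{0}\}$ has a multiplicative inverse $x^{-1}$ (with $\mathbb{1}\neq\mathbb{0}$). The order is $x\leq y\iff x\oplus y=y$; linearly ordered means this order is total. Radicable means that rational powers are defined: for every $x\in\mathbb{X}$ and integer $p\geq1$ there is $x^{1/p}\in\mathbb{X}$ with $(x^{1/p})^{p}=x$ (and $\mathbb{0}^{1/p}=\mathbb{0}$). Example: $\langle\mathbb{R}\cup\{-\infty\},-\infty,0,\max,+\rangle$. Vector and matrix operations (addition, multiplication, scalar multiplication) follow the usual formulas with $\oplus,\otimes$ in place of $+,\times$; inequalities between vectors are componentwise. A column vector is regular if none of its entries is $\mathbb{0}$; $\mathbb{X}_{+}^{n}$ is the set of regular vectors in $\mathbb{X}^{n}$. For regular $\bm{x}=(x_{i})$, $\bm{x}^{-}$ is the row vector with entries $x_{i}^{-1}$. $I$ is the identity matrix ($\mathbb{1}$ on the diagonal, $\mathbb{0}$ elsewhere), and $A^{0}=I$, $A^{p}=A^{p-1}A$. A matrix is reducible if it can be put into block-triangular form by simultaneous permutations of rows and columns, and irreducible otherwise. For $A=(a_{ij})\in\mathbb{X}^{n\times n}$: $\mathrm{tr}A=a_{11}\oplus\cdots\oplus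 a_{nn}$; $\mathrm{tr}^{1/k}(A)$ means $(\mathrm{tr}A)^{1/k}$; $\mathrm{Tr}(A)=\mathrm{tr}A\oplus\mathrm{tr}A^{2}\oplus\cdots\oplus\mathrm{tr}A^{n}$; $A^{\ast}=I\oplus A\oplus\cdots\oplus A^{n-1}$. The spectral radius of $A$ is its maximal eigenvalue (an eigenvalue is a scalar $\mu$ with $A\bm{x}=\mu\bm{x}$ for some nonzero vector $\bm{x}$), and it is given by $\lambda=\bigoplus_{m=1}^{n}\mathrm{tr}^{1/m}(A^{m})$. *)

(* Defs.v *)
From HB Require Import structures.
From mathcomp Require Import all_boot all_order all_fingroup all_algebra.

Set Implicit Arguments.
Unset Strict Implicit.
Unset Printing Implicit Defensive.

Import Order.TTheory GRing.Theory.
Local Open Scope ring_scope.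

(** Throughout, the semiring operations [+], [*], [0], [1] of MathComp play the
    roles of the idempotent operations: in max-plus algebra [+] is [max] and
    [*] is the usual addition. All derived operations of MathComp on semirings
    ([\sum], [\prod], [*m], [*:], [^+], [\tr]) are read accordingly. *)

(** [semifield_inv 0] is left unspecified. *)
HB.mixin Record ComNzSemiRing_isSemifield X of GRing.ComNzSemiRing X := {
  semifield_inv : X -> X;
  semifield_mulVx : forall x : X, x != 0 -> semifield_inv x * x = 1
}.

#[short(type="comSemifieldType")]
HB.structure Definition ComSemifield :=
  { X of GRing.ComNzSemiRing X & ComNzSemiRing_isSemifield X }.

(** The second axiom says that the order [x <= y <-> x + y = y] is total. *)
HB.mixin Record ComSemifield_isLinearlyOrderedIdempotent X
    of ComSemifield X := {
  idem_addxx : forall x : X, x + x = x;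
  idem_add_total : forall x y : X, (x + y == y) || (y + x == x)
}.

#[short(type="linIdemSemifieldType")]
HB.structure Definition LinIdemSemifield :=
  { X of ComSemifield X & ComSemifield_isLinearlyOrderedIdempotent X }.

(** [semifield_root p x] is [x^(1/p)]. It is unspecified for [p = 0]; for
    [p >= 1] it is determined by [semifield_rootK], since [x |-> x ^+ p] is
    injective on a linearly ordered idempotent semifield, and it maps 0 to 0. *)
HB.mixin Record LinIdemSemifield_isRadicable X of LinIdemSemifield X := {
  semifield_root : nat -> X -> X;
  semifield_rootK :
    forall (p : nat) (x : X), (0 < p)%N -> semifield_root p x ^+ p = x
}.

#[short(type="radIdemSemifieldType")]
HB.structure Definition RadIdemSemifield :=
  { X of LinIdemSemifield X & LinIdemSemifield_isRadicable X }.

Definition idem_le (X : radIdemSemifieldType) : rel X := fun x y => x + y == y.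

Section Order.
Variable X : radIdemSemifieldType.

Fact idem_le_refl : reflexive (@idem_le X).
Proof. by move=> x; rewrite /idem_le idem_addxx. Qed.

Fact idem_le_anti : antisymmetric (@idem_le X).
Proof. by move=> x y /andP[/eqP xy /eqP yx]; rewrite -yx addrC xy. Qed.

Fact idem_le_trans : transitive (@idem_le X).
Proof.
by move=> y x z /eqP xy /eqP yz; rewrite /idem_le -yz addrA xy.
Qed.

Fact idem_le_total : total (@idem_le X).
Proof. exact: idem_add_total. Qed.

End Order.

(** The order is put on the generic carrier, so that [<=] and [<] below are the
    order induced by the idempotent addition. *)
HB.instance Definition _ (X : radIdemSemifieldType) :=
  @Order.Le_isPOrder.Build ring_display (RadIdemSemifield.sort X)
    (@idem_le X) (@idem_le_refl X) (@idem_le_anti X) (@idem_le_trans X).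

HB.instance Definition _ (X : radIdemSemifieldType) :=
  @Order.POrder_isTotal.Build ring_display (RadIdemSemifield.sort X)
    (@idem_le_total X).

Lemma idem_leE (X : radIdemSemifieldType) (x y : X) : (x <= y) = (x + y == y).
Proof. by []. Qed.

Section Definitions.
Variables (X : radIdemSemifieldType) (n : nat).
Implicit Types (A B : 'M[X]_n) (x y : 'cV[X]_n).

Definition regular_vec x : Prop := forall i, x i 0 != 0.

Definition le_vec x y : Prop := forall i, x i 0 <= y i 0.

Definition conj_vec x : 'rV[X]_n := \row_i semifield_inv (x i 0).

(** The scalar [x^- A x]. *)
Definition objective A x : X := (conj_vec x *m A *m x) 0 0.

(** The diagonal blocks have sizes [m] and [n - m], both positive; hence every
    1 x 1 matrix is irreducible, including the zero one. *)
Definition reducible A : Prop :=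
  exists (s : 'S_n) (m : nat), (0 < m < n)%N /\
    forall i j : 'I_n, (i < m)%N -> (m <= j)%N ->
      (row_perm s (col_perm s A)) i j = 0.

Definition irreducible A : Prop := ~ reducible A.

Definition is_eigenvalue A (mu : X) : Prop :=
  exists x : 'cV[X]_n, x != 0 /\ A *m x = mu *: x.

Definition is_spectral_radius A (lambda : X) : Prop :=
  is_eigenvalue A lambda /\ forall mu, is_eigenvalue A mu -> mu <= lambda.

Definition Trace A : X := \sum_(1 <= m < n.+1) \tr (A ^+ m).

Definition star A : 'M[X]_n := \sum_(0 <= m < n) A ^+ m.

(** The inner sum ranges over all [k]-tuples of naturals with sum at most
    [n - k]; each component is then at most [n - k], whence the finite type. *)
Definition theta A B : X :=
  \sum_(1 <= k < n.+1)
    \sum_(i : {ffun 'I_k -> 'I_(n - k).+1} | (\sum_(j < k) i j <= n - k)%N)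
      semifield_root k (\tr (\prod_(j < k) (A * B ^+ i j))).

End Definitions.

(* Main.v *)
(** Put [C = theta^-1 A + B]. For regular [x], [x^- A x <= mu] means
    [A x <= mu x], so that together with [B x <= x] it gives
    [A B^i1 ... A B^ik x <= mu^k x]; reading off diagonal entries, every trace
    occurring in [theta] is at most [mu^k], whence [theta <= mu]. The solutions
    are therefore the regular [x] with [C x <= x]. Expanding [C^m] into words
    and rotating each word under the trace gives [Trace C <= 1], and then
    [C x <= x] holds exactly for [x = C^* u], because cutting a cycle out of a
    walk with [n] steps shows [C^n <= C^*]. A cycle in a walk contributing to
    [A^n x = lambda^n x <> 0] shows that [theta <> 0]. *)

Require Import Defs.
From mathcomp Require Import all_boot all_order all_fingroup all_algebra.

Set Implicit Arguments.
Unset Strict Implicit.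
Unset Printing Implicit Defensive.

Import Order.TTheory GRing.Theory.
Local Open Scope ring_scope.

(** * Order and cancellation in a linearly ordered idempotent semifield *)

Section ScalarOrder.
Variable X : radIdemSemifieldType.
Implicit Types x y z c : X.

Lemma idem_ge0 x : (0 : X) <= x.
Proof. by rewrite idem_leE add0r. Qed.

Lemma idem_le0 x : (x <= 0) = (x == 0).
Proof. by rewrite idem_leE addr0. Qed.

Lemma idem_ltx0 x : (x < 0) = false.
Proof. by rewrite lt_neqAle idem_le0 andNb. Qed.

Lemma idem_ge_neq0 x y : x <= y -> x != 0 -> y != 0.
Proof.
by move=> xy; apply: contra_neq => y0; apply/eqP; rewrite -idem_le0 -y0.
Qed.

Lemma idem_le_addl x y : x <= x + y.
Proof. by rewrite idem_leE addrA idem_addxx. Qed.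

Lemma idem_addE x y : x + y = Order.max x y.
Proof.
case: leP => [|/ltW]; rewrite idem_leE => /eqP //.
by rewrite addrC.
Qed.

Lemma idem_add_le x y z : (x + y <= z) = (x <= z) && (y <= z).
Proof. by rewrite idem_addE ge_max. Qed.

Lemma idem_sum_leP (I : Type) (r : seq I) (P : pred I) (F : I -> X) z :
  (forall i, P i -> F i <= z) -> \sum_(i <- r | P i) F i <= z.
Proof.
move=> Fz; elim/big_ind: _ => // [|x y xz yz]; first exact: idem_ge0.
by rewrite idem_add_le xz yz.
Qed.

Lemma idem_le_sum (I : eqType) (r : seq I) (P : pred I) (F : I -> X) i :
  i \in r -> P i -> F i <= \sum_(j <- r | P j) F j.
Proof.
by move=> ir Pi; rewrite (big_rem i ir) Pi idem_le_addl.
Qed.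

(** By totality a sum of two elements is one of them; being nonzero excludes the empty sum. *)
Lemma idem_sum_attained (I : Type) (r : seq I) (P : pred I) (F : I -> X) :
  \sum_(i <- r | P i) F i != 0 -> exists i, \sum_(j <- r | P j) F j = F i.
Proof.
elim/big_ind: _ => [|x y IHx IHy|i _ _]; [by rewrite eqxx| |by exists i].
by rewrite idem_addE; case: leP.
Qed.

Lemma idem_le_mul2l c x y : x <= y -> c * x <= c * y.
Proof. by rewrite !idem_leE => /eqP xy; rewrite -mulrDr xy. Qed.

Lemma idem_le_mul x y z t : x <= y -> z <= t -> x * z <= y * t.
Proof.
move=> xy zt; apply: le_trans (idem_le_mul2l _ zt) _.
by rewrite ![_ * t]mulrC idem_le_mul2l.
Qed.

Lemma idem_mulVf x : x != 0 -> semifield_inv x * x = 1.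
Proof. exact: semifield_mulVx. Qed.

Lemma idem_le_pmul2l c x y : c != 0 -> (c * x <= c * y) = (x <= y).
Proof.
move=> c0; apply/idP/idP; last exact: idem_le_mul2l.
by move/(idem_le_mul2l (semifield_inv c)); rewrite !mulrA idem_mulVf // !mul1r.
Qed.

Lemma idem_le_divl c x y : c != 0 -> (semifield_inv c * x <= y) = (x <= c * y).
Proof.
move=> c0.
by rewrite -(idem_le_pmul2l _ _ c0) mulrA [c * _]mulrC idem_mulVf ?mul1r.
Qed.

Lemma idem_mulf_neq0 x y : x != 0 -> y != 0 -> x * y != 0.
Proof.
by move=> x0 y0; rewrite -idem_le0 -(mulr0 x) idem_le_pmul2l ?idem_le0.
Qed.

Lemma idem_expf_neq0 x k : x != 0 -> x ^+ k != 0.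
Proof.
move=> x0; elim: k => [|k IHk]; first by rewrite expr0 oner_eq0.
by rewrite exprS idem_mulf_neq0.
Qed.

Lemma idem_le_exp k x y : x <= y -> x ^+ k <= y ^+ k.
Proof.
by move=> xy; elim: k => [|k IHk]; rewrite ?expr0 // !exprS idem_le_mul.
Qed.

Lemma idem_le_expI k x y : (0 < k)%N -> x ^+ k <= y ^+ k -> x <= y.
Proof.
case: k => // k _; case: (leP x y) => // yx xyk.
have x0 : x != 0 by apply/eqP => x0; rewrite x0 idem_ltx0 in yx.
suff: x <= y by rewrite leNgt yx.
(* From [y < x]: [x ^+ k.+1 <= y ^+ k.+1 <= x ^+ k * y], and [x ^+ k] cancels. *)
rewrite -(idem_le_pmul2l _ _ (idem_expf_neq0 k x0)) -exprSr.
rewrite (le_trans xyk) // exprSr mulrC [leRHS]mulrC idem_le_mul2l //.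
by rewrite idem_le_exp // ltW.
Qed.

Lemma idem_root_le k x y :
  (0 < k)%N -> (semifield_root k x <= y) = (x <= y ^+ k).
Proof.
move=> k0; apply/idP/idP => [/(idem_le_exp k)|].
  by rewrite semifield_rootK.
by rewrite -{1}(semifield_rootK k x k0) => /idem_le_expI; apply.
Qed.

End ScalarOrder.

(** * Monotonicity of matrix operations *)

Section MatrixOrder.
Variables (X : radIdemSemifieldType) (n : nat).
Implicit Types (A B C D : 'M[X]_n) (x y u : 'cV[X]_n).

Lemma le_vec_trans x y u : le_vec x y -> le_vec y u -> le_vec x u.
Proof. by move=> xy yu i; apply: le_trans (xy i) (yu i). Qed.

Lemma mulmx_le A C x y :
  (forall i j, A i j <= C i j) -> le_vec x y -> le_vec (A *m x) (C *m y).
Proof.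
move=> AC xy i; rewrite !mxE; apply: idem_sum_leP => j _.
apply: (@le_trans _ _ (C i j * y j 0)); first exact: idem_le_mul.
exact: (idem_le_sum (fun j => C i j * y j 0) (mem_index_enum j)).
Qed.

Lemma mulmx_le_entry A x i j : A i j * x j 0 <= (A *m x) i 0.
Proof.
rewrite mxE.
exact: (idem_le_sum (fun j => A i j * x j 0) (mem_index_enum j)).
Qed.

Lemma mulmx_entry_le A C i j k : A i j * C j k <= (A * C) i k.
Proof.
rewrite mxE.
exact: (idem_le_sum (fun j => A i j * C j k) (mem_index_enum j)).
Qed.

Lemma entry_le_mxtrace A i : A i i <= \tr A.
Proof. exact: (idem_le_sum (fun i => A i i) (mem_index_enum i)). Qed.

Lemma mxtrace_pow_le_Trace A m : (0 < m <= n)%N -> \tr (A ^+ m) <= Trace A.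
Proof.
move=> mn; apply: (idem_le_sum (fun m => \tr (A ^+ m))) => //.
by rewrite mem_index_iota ltnS.
Qed.

Lemma pow_le_star A m i j : (m < n)%N -> (A ^+ m) i j <= star A i j.
Proof.
move=> mn; rewrite /star summxE.
by apply: (idem_le_sum (fun m => (A ^+ m) i j)); rewrite ?mem_index_iota.
Qed.

(** * Matrix powers as maximal weights of walks *)

Fixpoint walk_weight C i (w : seq 'I_n) : X :=
  if w is k :: w' then C i k * walk_weight C k w' else 1.

Lemma walk_weight_cat C i w1 w2 :
  walk_weight C i (w1 ++ w2) =
  walk_weight C i w1 * walk_weight C (last i w1) w2.
Proof.
by elim: w1 i => [|k w1 IH] i /=; rewrite ?mul1r // IH mulrA.
Qed.

(** The list [w] omits the start vertex [i], so its size counts the steps. *)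
Lemma walk_weight_le C i w : walk_weight C i w <= (C ^+ size w) i (last i w).
Proof.
elim: w i => [|k w IH] i /=; first by rewrite expr0 mxE eqxx.
by rewrite exprS (le_trans _ (mulmx_entry_le _ _ _ k _)) // idem_le_mul2l.
Qed.

Lemma pow_attained_by_walk C m i j : (C ^+ m) i j != 0 ->
  exists w, [/\ size w = m, last i w = j & (C ^+ m) i j = walk_weight C i w].
Proof.
elim: m i => [|m IH] i.
  rewrite expr0 mxE; case: (i =P j) => [->|_]; last by rewrite eqxx.
  by exists [::].
rewrite exprS mxE => nz; case/idem_sum_attained: (nz) => k kE.
move: nz; rewrite kE => nz.
have/IH[w [sw lw ww]] : (C ^+ m) k j != 0.
  by apply: contra_neq nz => ->; rewrite mulr0.
by exists (k :: w); rewrite /= sw ww.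
Qed.

(** Either the start [i] recurs in [w], and the cycle begins at once, or the repetition lies in the
    tail. The cycle is [w2], based at [last i w1]. *)
Lemma walk_has_cycle i (w : seq 'I_n) : ~~ uniq (i :: w) ->
  exists w1 w2 w3, [/\ w = w1 ++ w2 ++ w3, (0 < size w2)%N
                     & last (last i w1) w2 = last i w1].
Proof.
elim: w i => // k w IH i; rewrite [uniq _]/= negb_and negbK => /orP[iw|].
  case/splitPr: iw => p1 p2; exists [::], (rcons p1 i), p2.
  by rewrite /= cat_rcons size_rcons last_rcons.
case/IH => w1 [w2 [w3 [-> w2_gt0 cyc]]].
by exists (k :: w1), w2, w3.
Qed.

(* Pigeonhole: a walk with n steps visits n + 1 vertices. *)
Lemma pow_dim_cycle C i j : exists s p q r,
  [/\ (0 < q)%N, (p + q + r = n)%N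
    & (C ^+ n) i j <= (C ^+ p) i s * (C ^+ q) s s * (C ^+ r) s j].
Proof.
have [->|/pow_attained_by_walk[w [sw lw ->]]] := eqVneq ((C ^+ n) i j) 0.
  (* For a zero entry any split will do; [n] is positive because ['I_n] contains [i]. *)
  exists i, 0%N, n, 0%N; rewrite addn0 add0n idem_ge0; split=> //.
  exact: leq_ltn_trans (ltn_ord i).
have: ~~ uniq (i :: w).
  apply/negP => /card_uniqP cw; have := max_card (mem (i :: w)).
  by rewrite cw /= sw card_ord ltnn.
case/walk_has_cycle => w1 [w2 [w3 [wE w2_gt0 cyc]]].
exists (last i w1), (size w1), (size w2), (size w3); split=> //.
  by move: sw; rewrite wE !size_cat addnA.
rewrite wE !walk_weight_cat cyc mulrA.
apply: idem_le_mul; first apply: idem_le_mul.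
- exact: walk_weight_le.
- by rewrite -[X in (C ^+ _) _ X]cyc walk_weight_le.
- by move: lw; rewrite wE !last_cat cyc => <-; exact: walk_weight_le.
Qed.

(** * The Kleene star and subinvariant vectors *)

Lemma pow_dim_le_star C i j : Trace C <= 1 -> (C ^+ n) i j <= star C i j.
Proof.
move=> TrC; have [s [p [q [r [q0 pqr le_n]]]]] := pow_dim_cycle C i j.
apply: le_trans le_n _; apply: (@le_trans _ _ ((C ^+ p) i s * (C ^+ r) s j)).
  (* The cycle factor is a diagonal entry of [C ^+ q], hence at most [Trace C <= 1]. *)
  apply: idem_le_mul => //; rewrite -[leRHS]mulr1 idem_le_mul2l //.
  apply: le_trans (entry_le_mxtrace _ _) _; apply: le_trans TrC.
  by apply: mxtrace_pow_le_Trace; rewrite q0 -pqr addnAC leq_addl.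
(* Once the cycle is cut out, [p + r < n] steps remain, since [0 < q]. *)
apply: le_trans (mulmx_entry_le _ _ _ _ _) _; rewrite -exprD pow_le_star //.
by rewrite -pqr addnAC -[X in (X < _)%N]addn0 ltn_add2l.
Qed.

Lemma mul_star_le C i j : Trace C <= 1 -> (C * star C) i j <= star C i j.
Proof.
move=> TrC; rewrite /star mulr_sumr summxE big_seq_cond.
(* The product is the sum of [C ^+ 1] to [C ^+ n]; only the top power is not already a term of the
   star. *)
apply: idem_sum_leP => m; rewrite mem_index_iota andbT /= -exprS leq_eqVlt.
case/predU1P => [->|mn]; first exact: pow_dim_le_star.
exact: pow_le_star.
Qed.

Lemma star_mul_ge C u : (0 < n)%N -> le_vec u (star C *m u).
Proof.
move=> n0; rewrite -[u in le_vec u _]mul1mx; apply: mulmx_le => // i j.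
exact: (pow_le_star C i j n0).
Qed.

Lemma subinvariant_vecP C x : (0 < n)%N -> Trace C <= 1 -> regular_vec x ->
  le_vec (C *m x) x <-> exists u, regular_vec u /\ x = star C *m u.
Proof.
move=> n0 TrC xreg; split=> [Cx|[u [ureg ->]]]; last first.
  by rewrite mulmxA; apply: mulmx_le => // i j; exact: mul_star_le.
(* The vector [x] generates itself: [C x <= x] iterates to [C ^+ m x <= x], and the term [I] of the
   star gives the reverse inequality. *)
exists x; split=> //; apply/matrixP => i j; rewrite ord1.
apply/le_anti; rewrite star_mul_ge //= mulmx_suml summxE.
apply: idem_sum_leP => m _; elim: m i => [|m IH] i.
  by rewrite expr0 mul1mx.
rewrite exprS -mulmxA; apply: le_trans (Cx i).
exact: mulmx_le.
Qed.

(** * The lower bound for the objective *)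

Lemma objective_le A x c : regular_vec x ->
  objective A x <= c <-> le_vec (A *m x) (c *: x).
Proof.
move=> xreg; rewrite /objective -mulmxA mxE; split=> [le_c i|Ax].
  rewrite [leRHS]mxE [leRHS]mulrC -idem_le_divl //; apply: le_trans le_c.
  have := idem_le_sum (P := xpredT)
    (fun i => conj_vec x 0 i * (A *m x) i 0) (mem_index_enum i) isT.
  by rewrite [conj_vec _ _ _]mxE.
apply: idem_sum_leP => i _; rewrite [conj_vec _ _ _]mxE idem_le_divl //.
by rewrite mulrC; have := Ax i; rewrite [leRHS]mxE.
Qed.

Lemma mxtrace_le_of_supereigen D x c : regular_vec x ->
  le_vec (D *m x) (c *: x) -> \tr D <= c.
Proof.
move=> xreg Dx; apply: idem_sum_leP => i _.
rewrite -(idem_le_pmul2l _ _ (xreg i)) mulrC.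
apply: le_trans (mulmx_le_entry _ _ _ _) _.
by rewrite (le_trans (Dx i)) // mxE mulrC.
Qed.

(** Powers of [B] keep [x] below itself, and each letter [A] costs one factor [c]. *)
Lemma prod_le_vec A B x c (s : seq nat) : le_vec (A *m x) (c *: x) ->
  le_vec (B *m x) x ->
  le_vec ((\prod_(e <- s) (A * B ^+ e)) *m x) (c ^+ size s *: x).
Proof.
move=> Ax Bx; have Bkx e : le_vec (B ^+ e *m x) x.
  elim: e => [|e IH]; first by rewrite expr0 mul1mx => i.
  by rewrite exprS -mulmxA; apply: le_vec_trans Bx; exact: mulmx_le.
elim: s => [|e s IH]; first by rewrite big_nil expr0 mul1mx scale1r => i.
rewrite big_cons -!mulmxA exprSr -scalerA.
apply: (le_vec_trans (mulmx_le _ (mulmx_le _ IH))) => // i.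
rewrite -!scalemxAr [leLHS]mxE [leRHS]mxE idem_le_mul2l //.
exact: le_vec_trans (mulmx_le _ (Bkx e)) Ax i.
Qed.

Lemma theta_le_objective A B x : regular_vec x -> le_vec (B *m x) x ->
  theta A B <= objective A x.
Proof.
move=> xreg Bx; have /(objective_le A _ xreg) Ax := lexx (objective A x).
rewrite /theta big_seq_cond; apply: idem_sum_leP => k.
rewrite mem_index_iota andbT => /andP[k0 _]; apply: idem_sum_leP => f _.
rewrite idem_root_le //; apply: (mxtrace_le_of_supereigen xreg).
have := prod_le_vec [seq f j : nat | j <- enum 'I_k] Ax Bx.
by rewrite size_map size_enum_ord big_map [index_enum _]unlock -enumT.
Qed.

(** * Traces of words in [A] and [B] *)

Lemma mxtrace_prod_le_theta A B (s : seq nat) :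
  (0 < size s)%N -> (size s + sumn s <= n)%N ->
  \tr (\prod_(e <- s) (A * B ^+ e)) <= theta A B ^+ size s.
Proof.
move=> s0 sn; rewrite -idem_root_le //.
have ks : (sumn s <= n - size s)%N by
  rewrite leq_subRL ?(leq_trans (leq_addr _ _) sn).
have nth_le j : (nth 0 s j <= n - size s)%N.
  apply: leq_trans ks; have [sj|js] := leqP (size s) j.
    by rewrite nth_default.
  by rewrite sumnE (big_nth 0%N) big_mkord (bigD1 (Ordinal js)) //= leq_addr.
(* The list becomes an index of the inner sum of [theta]; [nth_le] keeps [inord] away from its
   default value. *)
pose f : {ffun 'I_(size s) -> 'I_(n - size s).+1} :=
  [ffun j : 'I_(size s) => inord (nth 0%N s j)].
have fE (j : 'I_(size s)) : f j = nth 0%N s j :> nat by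
  rewrite ffunE inordK // ltnS.
have -> : \prod_(e <- s) (A * B ^+ e) = \prod_(j < size s) (A * B ^+ f j).
  by rewrite (big_nth 0%N) big_mkord; apply: eq_bigr => j _; rewrite fE.
have fs : (\sum_(j < size s) f j <= n - size s)%N.
  under eq_bigr do rewrite fE.
  by rewrite -(big_mkord xpredT (nth 0 s)) -(big_nth 0 xpredT id) -sumnE.
have sr : size s \in index_iota 1 n.+1.
  by rewrite mem_index_iota s0 ltnS (leq_trans (leq_addr _ _) sn).
pose root_tr k (g : {ffun 'I_k -> 'I_(n - k).+1}) :=
  semifield_root k (\tr (\prod_(j < k) (A * B ^+ g j))).
pose inner k := \sum_(g : {ffun 'I_k -> 'I_(n - k).+1} |
  (\sum_(j < k) g j <= n - k)%N) root_tr k g.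
apply: (@le_trans _ _ (inner (size s))); last first.
  exact: (idem_le_sum (P := xpredT) inner sr isT).
exact: (idem_le_sum (P := fun g : {ffun 'I_(size s) -> 'I_(n - size s).+1} =>
  (\sum_(j < size s) g j <= n - size s)%N) (@root_tr _) (mem_index_enum f) fs).
Qed.

(** Every word of length [m] is uniquely [B ^+ i] followed by blocks [A * B ^+ e]. The prefix [D]
    collects the letters already read: a new [A] closes the block of exponent [i], a new [B] raises
    [i]. *)
Lemma mxtrace_pow_sum_le A B D c m :
  (forall i (s : seq nat), (i + (size s + sumn s) = m)%N ->
     \tr (D * (B ^+ i * \prod_(e <- s) (A * B ^+ e))) <= c) ->
  \tr (D * (A + B) ^+ m) <= c.
Proof.
elim: m D => [|m IH] D le_c.
  by have := le_c 0%N [::] erefl; rewrite big_nil !expr0 !mulr1.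
rewrite exprS mulrDl mulrDr mxtraceD idem_add_le !mulrA.
apply/andP; split; apply: IH => i s ism.
- have := le_c 0%N (i :: s); rewrite big_cons expr0 mul1r -!mulrA; apply.
  by rewrite /= -ism add0n addSn addnCA.
- have := le_c i.+1 s; rewrite exprS -!mulrA; apply.
  by rewrite addSn ism.
Qed.

Lemma prod_scale A B c (s : seq nat) :
  \prod_(e <- s) ((c *: A) * B ^+ e) =
  c ^+ size s *: \prod_(e <- s) (A * B ^+ e).
Proof.
elim: s => [|e s IH]; first by rewrite !big_nil scale1r.
rewrite !big_cons IH -!mulmxE -!scalemxAl -scalemxAr scalerA exprS.
by rewrite -mulmxA.
Qed.

Lemma Trace_combined_le1 A B : theta A B != 0 -> Trace B <= 1 ->
  Trace (semifield_inv (theta A B) *: A + B) <= 1.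
Proof.
move=> th0 TrB; rewrite /Trace big_seq_cond; apply: idem_sum_leP => m.
rewrite mem_index_iota andbT ltnS => mn; rewrite -[_ ^+ m]mul1r.
apply: mxtrace_pow_sum_le => i s; rewrite mul1r.
(* A word without [A] is a power of [B], controlled by [Trace B]; any other has a last block to
   absorb the leading power of [B]. *)
case/lastP: s => [|s e ism].
  rewrite big_nil mulr1 /= !addn0 => ->.
  exact: le_trans (mxtrace_pow_le_Trace _ mn) TrB.
(* Cyclicity of the trace moves the leading power of [B] to the last factor. *)
have -> : \tr (B ^+ i * \prod_(e0 <- rcons s e)
              ((semifield_inv (theta A B) *: A) * B ^+ e0)) =
    \tr (\prod_(e0 <- rcons s (e + i)%N)
              ((semifield_inv (theta A B) *: A) * B ^+ e0)).
  rewrite -mulmxE mxtrace_mulC mulmxE -!cats1 !big_cat !big_seq1 /=.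
  by rewrite exprD !mulrA.
rewrite prod_scale mxtraceZ.
set t := rcons s _; have st : (size t + sumn t = m)%N.
  by rewrite -ism /t !size_rcons !sumn_rcons [RHS]addnC -!addnA.
have [m_gt0 m_len] := andP mn.
have t_gt0 : (0 < size t)%N by rewrite /t size_rcons.
(* The rotated word still has [m <= n] letters, so its trace is at most a power of [theta] that the
   scaling cancels. *)
have := @mxtrace_prod_le_theta A B t t_gt0; rewrite st => /(_ m_len).
move/(idem_le_mul2l (semifield_inv (theta A B) ^+ size t)).
by rewrite -exprMn idem_mulVf // expr1n.
Qed.

(** * Nonvanishing of [theta] *)

Lemma eigen_exp A x c m : A *m x = c *: x -> A ^+ m *m x = c ^+ m *: x.
Proof.
move=> Ax; elim: m => [|m IH]; first by rewrite !expr0 mul1mx scale1r.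
by rewrite exprSr -mulmxA Ax -scalemxAr IH scalerA exprS.
Qed.

Lemma theta_neq0 A B c : is_eigenvalue A c -> c != 0 -> theta A B != 0.
Proof.
case=> x [xn0 Ax] c0.
have [i xi] : exists i, x i 0 != 0.
  apply/existsP; apply: contraNT xn0; rewrite negb_exists => /forallP x0.
  apply/eqP/matrixP => i j; rewrite ord1 mxE; apply/eqP.
  by rewrite -[_ == _]negbK.
have sum_neq0 : \sum_j (A ^+ n) i j * x j 0 != 0.
  have := congr1 (fun y : 'cV_n => y i 0) (eigen_exp n Ax).
  by rewrite !mxE => ->; rewrite idem_mulf_neq0 ?idem_expf_neq0.
have /idem_sum_attained[j jE] := sum_neq0.
have Aij : (A ^+ n) i j != 0.
  by apply: contra_neq sum_neq0; rewrite jE => ->; rewrite mul0r.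
have [s [p [q [r [q0 pqr le_n]]]]] := pow_dim_cycle A i j.
have Ass : (A ^+ q) s s != 0.
  by apply: contra_neq (idem_ge_neq0 le_n Aij) => ->; rewrite mulr0 mul0r.
have qn : (q <= n)%N by move: pqr; rewrite addnAC => <-; exact: leq_addl.
(* With all exponents zero the word is [A ^+ q], whose trace dominates the nonzero cycle entry at
   [s]. *)
have := @mxtrace_prod_le_theta A B (nseq q 0%N).
rewrite size_nseq sumn_nseq mul0n addn0 big_nseq expr0 mulr1 iter_mulr_1.
move=> /(_ q0 qn) le_th.
apply: contra_neq (idem_ge_neq0 (le_trans (entry_le_mxtrace _ s) le_th) Ass).
by move=> ->; rewrite -(prednK q0) exprS mul0r.
Qed.

End MatrixOrder.

(** * The minimum and all its minimizers *)

Theorem theorem3 (X : radIdemSemifieldType) (n : nat) (A B : 'M[X]_n)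
    (lambda : X)
    (n_ge1 : (1 <= n)%N)
    (irrAB : irreducible A \/ irreducible B)
    (lambdaA : is_spectral_radius A lambda)
    (lambda_gt0 : (0 : X) < lambda)
    (TrB : Trace B <= 1) :
  [/\ exists x : 'cV[X]_n,
        [/\ regular_vec x, le_vec (B *m x) x & objective A x = theta A B],
      forall x : 'cV[X]_n,
        regular_vec x -> le_vec (B *m x) x -> theta A B <= objective A x
    & forall x : 'cV[X]_n,
        [/\ regular_vec x, le_vec (B *m x) x & objective A x = theta A B] <->
        exists u : 'cV[X]_n, regular_vec u /\
          x = star (semifield_inv (theta A B) *: A + B) *m u].
Proof.
have th0 : theta A B != 0.
  case: lambdaA => /theta_neq0 + _; apply; by rewrite gt_eqF.
set C := _ + B.
have TrC : Trace C <= 1 by exact: Trace_combined_le1.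
have feasP x : regular_vec x ->
    le_vec (B *m x) x /\ objective A x = theta A B <-> le_vec (C *m x) x.
  move=> xreg; have CE i : (C *m x) i 0 =
      semifield_inv (theta A B) * (A *m x) i 0 + (B *m x) i 0.
    by rewrite mulmxDl -scalemxAl !mxE.
  split=> [[Bx objE] i|Cx].
    rewrite CE idem_add_le idem_le_divl // Bx andbT.
    have /(objective_le A _ xreg)/(_ i) : objective A x <= theta A B.
      by rewrite objE.
    by rewrite [leRHS]mxE.
  have Bx : le_vec (B *m x) x.
    by move=> i; have := Cx i; rewrite CE idem_add_le => /andP[].
  (* Subinvariance yields only [objective A x <= theta A B]; the lower bound makes it an
     equality. *)
  split=> //; apply/le_anti; rewrite theta_le_objective // andbT.
  apply/objective_le => // i; have := Cx i.
  by rewrite CE idem_add_le idem_le_divl // [(_ *: x) i 0]mxE => /andP[].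
have star_reg u : regular_vec u -> regular_vec (star C *m u).
  by move=> ureg i; exact: idem_ge_neq0 (star_mul_ge _ _ n_ge1 i) (ureg i).
have solP x :
    [/\ regular_vec x, le_vec (B *m x) x & objective A x = theta A B] <->
    exists u : 'cV[X]_n, regular_vec u /\ x = star C *m u.
  split=> [[xreg Bx objE]|xE].
    by apply/subinvariant_vecP => //; apply/feasP.
  have xreg : regular_vec x by case: xE => u [/star_reg + ->].
  by have /(subinvariant_vecP n_ge1 TrC xreg)/(feasP _ xreg)[] := xE.
split=> //; last by move=> x; exact: theta_le_objective.
(* Any regular generator yields a minimizer; the all-ones vector is one. *)
exists (star C *m const_mx 1); apply/solP; exists (const_mx 1); split=> //.
by move=> i; rewrite mxE oner_eq0.
Qed.
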